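(* Let $q$ be an odd prime power, let $\alpha\in\mathbb{F}_q$ be a nonsquare, and let $n$ be a positive integer. Let $R_n(x,\alpha)$ be the degree-$n$ Rédei function and $C_n(x,\alpha)$ the degree-$n$ tangent-Chebyshev rational function over $\mathbb{F}_q$ with parameter $\alpha$. Then, as rational functions in $\mathbb{F}_q(x)$, \[ C_n(x,\alpha)=\frac1x\circ R_n(x,\alpha)\circ\frac1x, \] that is, $C_n(x,\alpha)=1/R_n(1/x,\alpha)$.
   Context: Let $q$ be an odd prime power and $\alpha$ a nonsquare in $\mathbb{F}_q$. Let $\beta\in\mathbb{F}_{q^2}$ be a root of $x^2-\alpha$, and put $\bar\beta:=\beta^q=-\beta$. Set $\rho(x):=(x-\bar\beta)/(x-\beta)$ and $\rho^{-1}(x):=(\beta x-\bar\beta)/(x-1)$, degree-one rational functions in $\mathbb{F}_{q^2}(x)$ that are inverse to each other under composition. The degree-$n$ Rédei function with parameter $\alpha$ is $R_n(x,\alpha):=\rho^{-1}\circ x^n\circ\rho$, i.e. \[ R_n(x,\alpha)=\frac{\beta(x-\bar\beta)^n-\bar\beta(x-\beta)^n}{(x-\bar\beta)^n-(x-\beta)^n}; \] it lies in $\mathbb{F}_q(x)$ and does not depend on the choice of the root $\beta$. The degree-$n$ tangent-Chebyshev rational function over $\mathbb{F}_q$ with parameter $\alpha$ is \[ C_n(x,\alpha):=\frac{\sum_{i=0}^{\lfloor (n-1)/2\rfloor}\binom{n}{2i+1}\alpha^i x^{2i+1}}{\sum_{i=0}^{\lfloor n/2\rfloor}\binom{n}{2i}\alpha^i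 x^{2i}}. \] *)

(* Defs.v *)
From HB Require Import structures.
From mathcomp Require Import all_boot all_order all_algebra all_field.

Set Implicit Arguments.
Unset Strict Implicit.
Unset Printing Implicit Defensive.

Import GRing.Theory.
Local Open Scope ring_scope.
Local Open Scope quotient_scope.

Notation "x %:F" := (@FracField.tofrac _ x) (format "x %:F") : ring_scope.

(** K(x) is [{fraction {poly K}}].  Substitution of [g] for the variable in [f], the coefficients being sent
    into [E] by [phi].  The value is computed from the chosen representative
    of [f], and is independent of it as soon as [g] is transcendental over the
    image of [phi] (see [ratf_evalE]); in particular for any nonconstant
    rational function [g], the only case used here. *)
Definition ratf_eval (K E : fieldType) (phi : {rmorphism K -> E})
    (g : E) (f : {fraction {poly K}}) : E :=
  (map_poly phi \n_(repr f)).[g] / (map_poly phi \d_(repr f)).[g].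

Lemma ratf_evalE (K E : fieldType) (phi : {rmorphism K -> E}) (g : E)
    (p r : {poly K}) :
    (forall s : {poly K}, s != 0 -> (map_poly phi s).[g] != 0) -> r != 0 ->
  ratf_eval phi g (p%:F / r%:F) = (map_poly phi p).[g] / (map_poly phi r).[g].
Proof.
move=> gP r0; set f := p%:F / r%:F.
have d0 : \d_(repr f) != 0 by apply: denom_ratioP.
have fE : f = (\n_(repr f))%:F / (\d_(repr f))%:F.
  rewrite -[LHS]reprK -{1}[repr f]Ratio_numden.
  rewrite -[_ / _](@reprK _ {fraction {poly K}}) reprK.
  unlock FracField.tofrac.
  rewrite -[X in _ = _ * X]FracField.pi_inv -[RHS]FracField.pi_mul.
  rewrite /FracField.mulf /FracField.invf /=.
  by rewrite !numden_Ratio ?oner_neq0 // mulr1 mul1r.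
have /eqP : p%:F * (\d_(repr f))%:F = (\n_(repr f))%:F * r%:F.
  apply/eqP; rewrite -eqr_div ?tofrac_eq0 //; exact/eqP.
rewrite -!tofracM tofrac_eq => /eqP e.
apply/eqP; rewrite /ratf_eval eqr_div ?gP //.
by rewrite -!hornerM -!rmorphM /= e.
Qed.

(** Composition [f(g(x))] in K(x), for nonconstant [g]. *)
Definition ratf_comp (K : fieldType) (f g : {fraction {poly K}}) :
    {fraction {poly K}} :=
  ratf_eval (@FracField.tofrac {poly K} \o polyC) g f.

Notation "f \Ro g" := (ratf_comp f g)
  (at level 50, left associativity) : ring_scope.

(** The embedding K(x) -> L(x) induced by the field embedding [iota]. *)
Definition ratf_map (K L : fieldType) (iota : {rmorphism K -> L})
    (f : {fraction {poly K}}) : {fraction {poly L}} :=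
  ratf_eval (@FracField.tofrac {poly L} \o polyC \o iota) ('X%:F) f.

Section Redei.
Variables (F : finFieldType) (L : fieldExtType F) (beta : L).

Definition redei_conj : L := beta ^+ #|F|.

Definition redei_rho : {fraction {poly L}} :=
  ('X - redei_conj%:P)%:F / ('X - beta%:P)%:F.

Definition redei_rho_inv : {fraction {poly L}} :=
  (beta *: 'X - redei_conj%:P)%:F / ('X - 1)%:F.

(** As an element of L(x); that it comes from a (unique) element of F(x) when
    [beta ^+ 2] is a nonsquare of F is not built into the definition. *)
Definition redei (n : nat) : {fraction {poly L}} :=
  redei_rho_inv \Ro ('X^n%:F \Ro redei_rho).

End Redei.

(** [n.-1] is n - 1 only for n > 0. *)
Definition tan_chebyshev (F : fieldType) (alpha : F) (n : nat) :
    {fraction {poly F}} :=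
  (\sum_(0 <= i < (n.-1)./2.+1)
      ('C(n, i.*2.+1)%:R * alpha ^+ i) *: 'X^(i.*2.+1))%:F
  / (\sum_(0 <= i < n./2.+1)
      ('C(n, i.*2)%:R * alpha ^+ i) *: 'X^(i.*2))%:F.

(* Main.v *)
Require Import Defs.
From HB Require Import structures.
From mathcomp Require Import all_boot all_order all_algebra all_field.
From mathcomp Require Import ring.
Set Implicit Arguments.
Unset Strict Implicit.
Unset Printing Implicit Defensive.

Import GRing.Theory.
Local Open Scope ring_scope.

(** Split the binomial expansion of (u + b v)^n according to the parity of the
    exponent of b: (u + b v)^n = E + b O, where E and O are forms of degree n in
    (u, v) whose coefficients involve only b^2.  With conj(beta) = - beta,
    taking u = x and v = 1 gives R_n = E(x, 1) / O(x, 1), while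
    C_n = O(1, x) / E(1, x); homogeneity identifies E(1/x, 1) / O(1/x, 1) with
    E(1, x) / O(1, x).  Substitutions are legitimate because all the rational
    functions that get substituted have a pole, hence are transcendental. *)

(** * The forms E and O, over an arbitrary commutative ring so that they can be moved between K[x],
    L[x] and fraction fields *)

Definition even_form (A : comPzRingType) (n : nat) (a u v : A) : A :=
  \sum_(0 <= i < n./2.+1)
    ('C(n, i.*2)%:R * a ^+ i) * (u ^+ (n - i.*2) * v ^+ i.*2).

Definition odd_form (A : comPzRingType) (n : nat) (a u v : A) : A :=
  \sum_(0 <= i < (n.-1)./2.+1)
    ('C(n, i.*2.+1)%:R * a ^+ i) * (u ^+ (n - i.*2.+1) * v ^+ i.*2.+1).

Lemma big_nat_parity (V : nmodType) (f : nat -> V) n :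
  \sum_(0 <= k < n) f k
    = \sum_(0 <= i < uphalf n) f i.*2 + \sum_(0 <= i < n./2) f i.*2.+1.
Proof.
elim: n => [|n IHn]; first by rewrite !big_geq // addr0.
rewrite big_nat_recr //= IHn uphalf_half.
case: (boolP (odd n)) => odd_n /=; rewrite ?add1n ?add0n.
  rewrite [X in _ = _ + X]big_nat_recr //= addrA; congr (_ + f _).
  by rewrite -[LHS]odd_double_half odd_n.
rewrite [X in _ = X + _]big_nat_recr //= addrAC; congr (_ + f _).
by rewrite -[LHS]odd_double_half (negbTE odd_n).
Qed.

Lemma exprD_parity (A : comPzRingType) n (a b u v : A) :
    (0 < n)%N -> b ^+ 2 = a ->
  (u + b * v) ^+ n = even_form n a u v + b * odd_form n a u v.
Proof.
case: n => // n _ <-; rewrite exprDn.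
rewrite -(big_mkord xpredT
  (fun k => u ^+ (n.+1 - k) * (b * v) ^+ k *+ 'C(n.+1, k))).
(* With exponent [n.+1], the [n.+2] indices split into [(n.+1)./2.+1] even and [n./2.+1] odd ones,
   exactly the ranges of the two forms. *)
rewrite big_nat_parity /even_form /odd_form mulr_sumr /=.
congr (_ + _); apply: eq_bigr => i _.
  rewrite -mulr_natl exprMn -exprM mul2n; ring.
rewrite -mulr_natl exprMn -exprM mul2n exprS; ring.
Qed.

Section Forms.
Variables (A B : comPzRingType) (phi : {rmorphism A -> B}) (n : nat).

Lemma rmorph_even_form (a u v : A) :
  phi (even_form n a u v) = even_form n (phi a) (phi u) (phi v).
Proof.
rewrite rmorph_sum; apply: eq_bigr => i _.
by rewrite !rmorphM !rmorphXn rmorph_nat.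
Qed.

Lemma rmorph_odd_form (a u v : A) :
  phi (odd_form n a u v) = odd_form n (phi a) (phi u) (phi v).
Proof.
rewrite rmorph_sum; apply: eq_bigr => i _.
by rewrite !rmorphM !rmorphXn rmorph_nat.
Qed.

Lemma even_formZ (c a u v : A) :
  even_form n a (c * u) (c * v) = c ^+ n * even_form n a u v.
Proof.
rewrite mulr_sumr; apply: eq_big_nat => i /andP[_ le_i].
(* The range gives [i.*2 <= n], so the truncated subtraction is exact and every term has degree
   n. *)
have <- : c ^+ (n - i.*2) * c ^+ i.*2 = c ^+ n.
  rewrite -exprD subnK //; rewrite ltnS in le_i.
  by rewrite -[leqRHS]odd_double_half (leq_trans _ (leq_addl _ _)) ?leq_double.
by rewrite !exprMn; ring.
Qed.

Lemma odd_formZ (c a u v : A) : (0 < n)%N ->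
  odd_form n a (c * u) (c * v) = c ^+ n * odd_form n a u v.
Proof.
case: n => // m _; rewrite mulr_sumr; apply: eq_big_nat => i /andP[_ le_i].
rewrite !exprMn.
have <- : c ^+ (m.+1 - i.*2.+1) * c ^+ i.*2.+1 = c ^+ m.+1.
  rewrite -exprD subnK // ltnS; rewrite ltnS /= in le_i.
  by rewrite -[leqRHS]odd_double_half (leq_trans _ (leq_addl _ _)) ?leq_double.
ring.
Qed.

End Forms.

(** Together with [odd_form0], this shows that E(1, x) / O(1, x) has a pole at x = 0. *)
Lemma even_form0 (A : comPzRingType) n (a u : A) : even_form n a u 0 = u ^+ n.
Proof.
rewrite /even_form big_nat_recl // big1 => [|i _]; last by rewrite expr0n !mulr0.
by rewrite addr0 bin0 subn0 !mulr1 mul1r.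
Qed.

Lemma odd_form0 (A : comPzRingType) n (a u : A) : odd_form n a u 0 = 0.
Proof. by rewrite /odd_form big1 => [//|i _]; rewrite expr0n !mulr0. Qed.

Lemma horner_map_even_form (K E : fieldType) (phi : {rmorphism K -> E}) n
    (a : K) (g : E) :
  (map_poly phi (even_form n a%:P 'X 1)).[g] = even_form n (phi a) g 1.
Proof.
rewrite rmorph_even_form /= map_polyC map_polyX rmorph1.
rewrite -/(horner_eval g _) rmorph_even_form rmorph1 /= /horner_eval.
by rewrite hornerX hornerC.
Qed.

Lemma horner_map_odd_form (K E : fieldType) (phi : {rmorphism K -> E}) n
    (a : K) (g : E) :
  (map_poly phi (odd_form n a%:P 'X 1)).[g] = odd_form n (phi a) g 1.
Proof.
rewrite rmorph_odd_form /= map_polyC map_polyX rmorph1.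
rewrite -/(horner_eval g _) rmorph_odd_form rmorph1 /= /horner_eval.
by rewrite hornerX hornerC.
Qed.

Lemma horner_map_deg1 (K E : fieldType) (phi : {rmorphism K -> E})
    (b c : K) (g : E) :
  (map_poly phi (b *: 'X - c%:P)).[g] = phi b * g - phi c.
Proof.
by rewrite -mul_polyC rmorphB rmorphM /= map_polyX !map_polyC !hornerE.
Qed.

(** * Substitution of a rational function that has a pole *)

Section Substitution.
Variable K : fieldType.
Local Notation cst := (@FracField.tofrac {poly K} \o polyC).

(** Clearing denominators homogenises s, so that the vanishing of s(p/r) in K(x) becomes a question
    about polynomials, which can be evaluated at a point. *)
Lemma horner_map_frac (s p r : {poly K}) : r != 0 ->
  (map_poly cst s).[p%:F / r%:F] * r%:F ^+ (size s).-1
    = (\sum_(i < size s) s`_i *: (p ^+ i * r ^+ ((size s).-1 - i)))%:F.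
Proof.
move=> r0; have rF0 : r%:F != 0 by rewrite tofrac_eq0.
rewrite horner_coef size_map_poly mulr_suml rmorph_sum.
apply: eq_bigr => i _; rewrite coef_map /= -mul_polyC !rmorphM !rmorphXn /=.
have le_i : (i <= (size s).-1)%N by case: (size s) i => [[]|m i] //=; rewrite -ltnS.
rewrite -{1}(subnK le_i) exprD expr_div_n -!mulrA; congr (_ * (_ * _)).
rewrite mulrCA mulVf; first exact: mulr1.
exact: expf_neq0.
Qed.

(* At a pole only the leading term of the homogenised s survives. *)
Lemma pole_transcendental (p r : {poly K}) (c : K) :
    r != 0 -> root r c -> ~~ root p c ->
  forall s : {poly K}, s != 0 -> (map_poly cst s).[p%:F / r%:F] != 0.
Proof.
move=> r0 /eqP rc pc s s0; apply/eqP => s_g0.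
have := horner_map_frac s p r0; rewrite s_g0 mul0r => /esym/eqP.
rewrite tofrac_eq0 => /eqP/(congr1 (horner_eval c)).
rewrite /horner_eval horner0 horner_sum.
have: (0 < size s)%N by rewrite size_poly_gt0.
have := lead_coefE s; case: (size s) => // d /= lc _.
rewrite big_ord_recr /= big1 => [|i _]; last first.
  by rewrite hornerZ hornerM !horner_exp rc expr0n subn_eq0 leqNgt ltn_ord !mulr0.
move/eqP; rewrite add0r subnn mulr1 hornerZ horner_exp -lc mulf_eq0 lead_coef_eq0.
by rewrite (negbTE s0) /=; apply/negP; rewrite expf_neq0.
Qed.

Lemma ratf_comp_pole (p r f g : {poly K}) (c : K) :
    r != 0 -> root r c -> ~~ root p c -> g != 0 ->
  (f%:F / g%:F) \Ro (p%:F / r%:F)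
    = (map_poly cst f).[p%:F / r%:F] / (map_poly cst g).[p%:F / r%:F].
Proof.
by move=> r0 rc pc g0; apply: ratf_evalE g0; apply: pole_transcendental rc pc.
Qed.

End Substitution.

Lemma ratf_map_frac (K L : fieldType) (iota : {rmorphism K -> L})
    (p r : {poly K}) : r != 0 ->
  ratf_map iota (p%:F / r%:F) = (map_poly iota p)%:F / (map_poly iota r)%:F.
Proof.
(* Evaluation at x merely maps coefficients, so it is injective on polynomials and [ratf_evalE]
   applies. *)
have evX (s : {poly K}) :
    (map_poly (@FracField.tofrac {poly L} \o polyC \o iota) s).['X%:F]
      = (map_poly iota s)%:F.
  rewrite horner_coef size_map_poly -[in RHS](coefK (map_poly iota s)).
  rewrite size_map_poly poly_def rmorph_sum; apply: eq_bigr => i _.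
  by rewrite !coef_map /= -mul_polyC rmorphM rmorphXn.
move=> r0; rewrite /ratf_map ratf_evalE ?evX // => s s0.
by rewrite evX tofrac_eq0 map_poly_eq0.
Qed.

(** * The conjugate of beta *)

Lemma redei_conj_sqrt (F : finFieldType) (alpha : F) (L : fieldExtType F)
    (beta : L) :
    ~ (exists y : F, y ^+ 2 = alpha) -> beta ^+ 2 = alpha%:A ->
  redei_conj beta = - beta /\ - beta != beta.
Proof.
move=> nsq bb.
have bq : redei_conj beta != beta.
  apply/eqP => /eqP; rewrite -subr_eq0 /redei_conj => bq0; apply: nsq.
  (* The roots in L of X^q - X = prod_(x in F) (X - x) all lie in F. *)
  have := congr1 (fun p => (map_poly (in_alg L) p).[beta]) (finField_genPoly F).
  rewrite rmorphB rmorphXn /= map_polyX !hornerE (eqP bq0).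
  rewrite rmorph_prod horner_prod => /esym/eqP/prodf_eq0[x _].
  rewrite rmorphB /= map_polyX map_polyC !hornerE subr_eq0 => /eqP bx.
  exists x; apply: (fmorph_inj (in_alg L)).
  by rewrite rmorphXn /= -[RHS]bb bx.
(* Since alpha^q = alpha, beta^q is again a square root of alpha, hence beta or - beta; the first
   case has just been excluded. *)
have : redei_conj beta ^+ 2 == beta ^+ 2.
  rewrite /redei_conj -exprM mulnC exprM bb -in_algE -rmorphXn /=.
  by rewrite expf_card.
rewrite eqf_sqr (negbTE bq) /= => /eqP bqN; split=> //.
by rewrite -bqN.
Qed.

(** * The tangent-Chebyshev side *)

Lemma tan_chebyshevE (K : fieldType) (a : K) n :
  tan_chebyshev a n
    = (odd_form n a%:P 1 'X)%:F / (even_form n a%:P 1 'X)%:F.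
Proof.
by congr (_%:F / _%:F); apply: eq_bigr => i _;
  rewrite expr1n mul1r -mul_polyC polyCM polyC_natr polyC_exp.
Qed.

Lemma tan_chebyshev_comp (K : fieldType) (a : K) n :
    (0 < n)%N -> odd_form n a%:P 'X 1 != 0 ->
  tan_chebyshev a n = ('X%:F)^-1 \Ro
    ((even_form n a%:P 'X 1)%:F / (odd_form n a%:P 'X 1)%:F \Ro ('X%:F)^-1).
Proof.
move=> n_gt0 O0; rewrite tan_chebyshevE.
have X0 : ('X : {poly K}) != 0 by rewrite polyX_eq0.
have XF0 : ('X : {poly K})%:F != 0 by rewrite tofrac_eq0.
have XV : ('X%:F)^-1 = (1 : {poly K})%:F / 'X%:F by rewrite tofrac1 div1r.
have rX : root ('X : {poly K}) 0 by rewrite rootX.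
have r1 : ~~ root (1 : {poly K}) 0 by rewrite root1.
(* Writing 1 = x^-1 * x, homogeneity extracts x^-n from both forms; the factor cancels in the
   quotient. *)
have evenV : even_form n a%:P%:F ('X%:F)^-1 1
    = ('X%:F)^-1 ^+ n * (even_form n a%:P 1 'X)%:F.
  by rewrite rmorph_even_form rmorph1 -even_formZ mulr1 mulVf.
have oddV : odd_form n a%:P%:F ('X%:F)^-1 1
    = ('X%:F)^-1 ^+ n * (odd_form n a%:P 1 'X)%:F.
  by rewrite rmorph_odd_form rmorph1 -odd_formZ // mulr1 mulVf.
have XnV0 : ('X : {poly K})%:F^-1 ^+ n != 0 by rewrite expf_neq0 ?invr_eq0.
(* 1/x has a pole at 0, so it is not a root of the nonzero polynomial O(x, 1). *)
have OD0 : odd_form n a%:P 1 'X != 0.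
  have := pole_transcendental X0 rX r1 O0.
  by rewrite -XV horner_map_odd_form oddV mulf_eq0 (negbTE XnV0) /= tofrac_eq0.
have -> : (even_form n a%:P 'X 1)%:F / (odd_form n a%:P 'X 1)%:F \Ro ('X%:F)^-1
    = (even_form n a%:P 1 'X)%:F / (odd_form n a%:P 1 'X)%:F.
  rewrite {1}XV (ratf_comp_pole _ X0 rX r1 O0) -XV.
  by rewrite horner_map_even_form horner_map_odd_form evenV oddV -mulf_div divff ?mul1r.
(* The outer substitution uses the pole at 0: O(1, 0) = 0 while E(1, 0) = 1. *)
rewrite {1}XV (@ratf_comp_pole _ _ _ _ _ 0) //.
- by rewrite map_polyX rmorph1 hornerX -[1](polyC1) hornerC div1r invf_div.
- rewrite /root -/(horner_eval 0 _) rmorph_odd_form.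
  by rewrite /= /horner_eval !hornerE odd_form0.
- rewrite /root -/(horner_eval 0 _) rmorph_even_form.
  by rewrite /= /horner_eval !hornerE even_form0 expf_neq0 ?oner_neq0.
Qed.

(** * The Rédei side and the descent to F *)

Lemma redei_quotient (E : fieldType) (x y b : E) :
    y != 0 -> b + b != 0 -> x - b * y != 0 ->
  (b * ((x + b * y) / (x - b * y)) + b) / ((x + b * y) / (x - b * y) - 1)
    = x / y.
Proof.
move=> y0 b20 xy0.
have -> : b * ((x + b * y) / (x - b * y)) + b = (b + b) * x / (x - b * y).
  by field.
(* Numerator and denominator share the nonzero factor 2b / (x - b y). *)
have -> : (x + b * y) / (x - b * y) - 1 = (b + b) * y / (x - b * y) by field.
by rewrite invf_div mulrA divfK // -mulf_div divff // mul1r.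
Qed.

(** The powers (x + beta)^n and (x - beta)^n are E + beta O and E - beta O, and [redei_quotient]
    turns the inverse of rho at their ratio into E/O. Only beta^2 = alpha enters the forms, so E/O
    already has coefficients in F. *)
Lemma redei_even_odd (F : finFieldType) (alpha : F) (L : fieldExtType F)
    (beta : L) n :
    beta ^+ 2 = alpha%:A -> redei_conj beta = - beta -> - beta != beta ->
    (0 < n)%N ->
  odd_form n alpha%:P 'X 1 != 0 /\
  ratf_map (in_alg L)
    ((even_form n alpha%:P 'X 1)%:F / (odd_form n alpha%:P 'X 1)%:F)
    = redei beta n.
Proof.
move=> bb conjE bN n_gt0.
pose E : {poly L} := even_form n (alpha%:A)%:P 'X 1.
pose O : {poly L} := odd_form n (alpha%:A)%:P 'X 1.
have mapE : map_poly (in_alg L) (even_form n alpha%:P 'X 1) = E.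
  by rewrite rmorph_even_form /= map_polyC map_polyX rmorph1.
have mapO : map_poly (in_alg L) (odd_form n alpha%:P 'X 1) = O.
  by rewrite rmorph_odd_form /= map_polyC map_polyX rmorph1.
have plusn : ('X + beta%:P) ^+ n = E + beta%:P * O.
  by rewrite -[beta%:P in LHS]mulr1 (@exprD_parity _ _ (alpha%:A)%:P) // -polyC_exp bb.
have minusn : ('X - beta%:P) ^+ n = E - beta%:P * O.
  rewrite -[beta%:P in LHS]mulr1 -mulNr (exprD_parity _ _ n_gt0 (erefl _)).
  by rewrite sqrrN -polyC_exp bb mulNr.
have bb0 : beta + beta != 0 by rewrite addr_eq0 eq_sym.
have P_b : ('X + beta%:P).[beta] ^+ n != 0 by rewrite !hornerE expf_neq0.
have O0 : O != 0.
  (* If O were zero, both powers would equal E; but at beta one is (2 beta)^n, which is nonzero, and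
     the other is 0. *)
  apply: contraNneq P_b => O0; rewrite -horner_exp plusn O0 mulr0 addr0.
  have -> : E = ('X - beta%:P) ^+ n by rewrite minusn O0 mulr0 subr0.
  by rewrite horner_exp !hornerE subrr expr0n gtn_eqF.
have M0 : ('X - beta%:P) != 0 by rewrite polyXsubC_eq0.
have Mn0 : ('X - beta%:P) ^+ n != 0 by rewrite expf_neq0.
have OF0 : odd_form n alpha%:P 'X 1 != 0.
  by apply: contraNneq O0 => O0; rewrite -mapO O0 rmorph0.
split=> //; rewrite ratf_map_frac // mapE mapO /redei.
have -> : 'X^n%:F \Ro redei_rho beta
    = (('X + beta%:P) ^+ n)%:F / (('X - beta%:P) ^+ n)%:F.
  rewrite /redei_rho conjE polyCN opprK -['X^n%:F]divr1 -tofrac1.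
  rewrite (@ratf_comp_pole _ _ _ _ _ beta) ?oner_neq0 ?root_XsubC //.
    rewrite rmorph1 rmorphXn /= map_polyX -[X in _ / X.[_]](polyC1) hornerC.
    by rewrite horner_exp hornerX divr1 expr_div_n -!rmorphXn.
  by rewrite /root !hornerE.
(* rho^n keeps the pole of rho at beta, as n > 0 and its numerator takes the nonzero value (2
   beta)^n there. *)
rewrite /redei_rho_inv (@ratf_comp_pole _ _ _ _ _ beta) //; last first.
- by rewrite -[1](polyC1) polyXsubC_eq0.
- by rewrite /root horner_exp.
- by rewrite /root horner_exp !hornerE subrr expr0n gtn_eqF.
have -> : 'X - 1 = 1 *: 'X - 1%:P :> {poly L} by rewrite scale1r.
rewrite !horner_map_deg1 conjE /= polyC1 tofrac1 mul1r polyCN tofracN opprK.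
have Mn0F : (('X - beta%:P) ^+ n)%:F != 0 by rewrite tofrac_eq0.
have OFr0 : O%:F != 0 by rewrite tofrac_eq0.
have b20 : beta%:P%:F + beta%:P%:F != 0.
  by rewrite -!rmorphD tofrac_eq0 polyC_eq0.
move: Mn0F; rewrite plusn minusn tofracB tofracD tofracM => Mn0F.
exact: (esym (redei_quotient OFr0 b20 Mn0F)).
Qed.

Theorem mainTheorem1 (F : finFieldType) (oddq : odd #|F|)
    (alpha : F) (alpha_nsq : ~ exists y : F, y ^+ 2 = alpha)
    (L : fieldExtType F) (dimL : \dim {:L} = 2%N)
    (beta : L) (beta_root : root ('X^2 - (alpha%:A)%:P) beta)
    (n : nat) (n_gt0 : (0 < n)%N) :
  exists R : {fraction {poly F}},
    ratf_map (in_alg L) R = redei beta n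
    /\ tan_chebyshev alpha n = ('X%:F)^-1 \Ro (R \Ro ('X%:F)^-1).
Proof.
have bb : beta ^+ 2 = alpha%:A.
  by apply/eqP; rewrite -subr_eq0; move: beta_root; rewrite /root !hornerE.
have [conjE bN] := @redei_conj_sqrt F alpha L beta alpha_nsq bb.
have [O0 RE] := redei_even_odd bb conjE bN n_gt0.
exists ((even_form n alpha%:P 'X 1)%:F / (odd_form n alpha%:P 'X 1)%:F).
split=> //; exact: tan_chebyshev_comp.
Qed.
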